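(* Let $\mathcal N$ be the big model of a complete first order or continuous theory, and consider ternary relations on the small subsets of $\mathcal N$. (1) Suppose $\downarrow^I$ and $\downarrow^J$ are countably based. If $A\downarrow^I_C B\Rightarrow A\downarrow^J_C B$ holds for all countable $A,B,C$, then it holds for all small $A,B,C$. (2) Suppose $\downarrow^I$ has monotonicity. There is a unique ternary relation $\downarrow^{Ic}$ that is countably based and agrees with $\downarrow^I$ on countable sets. Namely, $A\downarrow^{Ic}_C B$ if and only if for all countable $A'\subseteq A$, $B'\subseteq B$, $C'\subseteq C$ there is a countable $D\in[C',C]$ such that $A'\downarrow^I_D B'$. (3) $\downarrow^I$ is countably based if and only if $\downarrow^I$ has monotonicity and two-sided countable character, and whenever $A$ and $B$ are countable (and $C$ is small), we have $$A\downarrow^I_C B\iff\text{for every countable }C'\subseteq C\text{ there is a countable }D\in[C',C]\text{ with }A\downarrow^I_D B.$$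
   Context: $\upsilon$ is a fixed uncountable inaccessible cardinal; the big model is the saturated model of cardinality $\upsilon$ (or the finite model); small means of cardinality $<\upsilon$; countable means of cardinality $\le\aleph_0$. $[A,B]=\{D:A\subseteq D\subseteq B\}$. A ternary relation $\downarrow^I$ is countably based if for all small $A,B,C$: $A\downarrow^I_C B$ iff for all countable $A'\subseteq A$, $B'\subseteq B$, $C'\subseteq C$ there is a countable $D\in[C',C]$ with $A'\downarrow^I_D B'$. Monotonicity: $A\downarrow_C B$, $A'\subseteq A$, $B'\subseteq B$ imply $A'\downarrow_C B'$. Two-sided countable character: if $A_0\downarrow^I_C B_0$ for all countable $A_0\subseteq A$ and all countable $B_0\subseteq B$, then $A\downarrow^I_C B$. *)

(* Defs.v *)
From mathcomp Require Import all_boot all_order all_algebra.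
From mathcomp Require Import all_classical all_reals all_analysis.

Set Implicit Arguments.
Unset Strict Implicit.
Unset Printing Implicit Defensive.

Import Order.TTheory GRing.Theory Num.Theory.
Import numFieldNormedType.Exports.

Local Open Scope classical_set_scope.
Local Open Scope card_scope.
Local Open Scope ring_scope.

(* A cardinal is represented by a type having that
   cardinality. *)

Definition card_lt T U (A : set T) (B : set U) : Prop := A #<= B /\ ~ (B #<= A).

(* Every cardinal below that of U is the cardinal of a subset of U, so it is
   enough to quantify over subsets of U. *)
Record inaccessible (U : Type) : Prop := Inaccessible {
  inaccessible_uncountable : ~ countable [set: U] ;
  inaccessible_strong_limit : forall X : set U,
    card_lt X [set: U] -> card_lt [set Y : set U | Y `<=` X] [set: U] ;
  inaccessible_regular : forall (I : set U) (F : U -> set U),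
    card_lt I [set: U] -> (forall i, I i -> card_lt (F i) [set: U]) ->
    card_lt (\bigcup_(i in I) F i) [set: U] }.

(** Syntax is well scoped: [term ar n] and [formula L n] have their free
    variables in 'I_n, and a quantifier binds the variable 0 of 'I_(1 + n). *)

Inductive term (F : Type) (ar : F -> nat) (n : nat) : Type :=
| Var of 'I_n
| App (f : F) of ('I_(ar f) -> term ar n).

Fixpoint teval (F : Type) (ar : F -> nat) (M : Type)
    (I : forall f, ('I_(ar f) -> M) -> M) (n : nat) (v : 'I_n -> M)
    (t : term ar n) : M :=
  match t with
  | Var i => v i
  | App f ts => I f (fun i => teval I v (ts i))
  end.

Definition vcat (M : Type) (m n : nat) (x : 'I_m -> M) (v : 'I_n -> M)
    (i : 'I_(m + n)) : M :=
  match fintype.split i with inl j => x j | inr j => v j end.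

Definition vcons (M : Type) (n : nat) (x : M) (v : 'I_n -> M) :
    'I_(1 + n) -> M :=
  vcat (fun=> x) v.

Definition vnil (M : Type) (i : 'I_0) : M := False_rect M (notF (ltn_ord i)).

(** First order logic (with equality) *)

Record fo_signature := FOSignature {
  ffun_sym : Type ;
  ffun_ar : ffun_sym -> nat ;
  frel_sym : Type ;
  frel_ar : frel_sym -> nat }.

Inductive formula (L : fo_signature) : nat -> Type :=
| Falsum n : formula L n
| Equal n of term (@ffun_ar L) n & term (@ffun_ar L) n : formula L n
| Rel n (P : frel_sym L) of ('I_(frel_ar P) -> term (@ffun_ar L) n) :
    formula L n
| Imp n of formula L n & formula L n : formula L n
| All n of formula L (1 + n) : formula L n.

Record fo_structure (L : fo_signature) := FOStructure {
  fo_carrier :> Type ;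
  fo_nonempty : inhabited fo_carrier ;
  fo_fun : forall f : ffun_sym L, ('I_(ffun_ar f) -> fo_carrier) -> fo_carrier ;
  fo_rel : forall P : frel_sym L, ('I_(frel_ar P) -> fo_carrier) -> Prop }.

Fixpoint sat (L : fo_signature) (M : fo_structure L) (n : nat)
    (p : formula L n) : ('I_n -> M) -> Prop :=
  match p in formula _ n return ('I_n -> M) -> Prop with
  | Falsum _ => fun=> False
  | Equal _ t u => fun v => teval (@fo_fun L M) v t = teval (@fo_fun L M) v u
  | Rel _ P ts => fun v => @fo_rel L M P (fun i => teval (@fo_fun L M) v (ts i))
  | Imp _ p q => fun v => sat p v -> sat q v
  | All _ p => fun v => forall x : M, sat p (vcons x v)
  end.

Definition fo_theory (L : fo_signature) := set (formula L 0).

Definition fo_models (L : fo_signature) (M : fo_structure L)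
    (T : fo_theory L) : Prop :=
  forall p, T p -> sat p (@vnil M).

Definition fo_complete (L : fo_signature) (T : fo_theory L) : Prop :=
  (exists M : fo_structure L, fo_models M T) /\
  forall p : formula L 0,
    (forall M : fo_structure L, fo_models M T -> sat p (@vnil M)) \/
    (forall M : fo_structure L, fo_models M T -> ~ sat p (@vnil M)).

(* [(k, p, a)] is the formula p(x, a) in the n variables x, where the parameters
   a are elements of M. *)
Definition fo_pformula (L : fo_signature) (M : fo_structure L) (n : nat) :=
  {k : nat & formula L (n + k) * ('I_k -> M)}%type.

Definition fo_psat (L : fo_signature) (M : fo_structure L) (n : nat)
    (x : 'I_n -> M) (g : fo_pformula M n) : Prop :=
  sat (tagged g).1 (vcat x (tagged g).2).

Definition fo_over (L : fo_signature) (M : fo_structure L) (n : nat)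
    (A : set M) (g : fo_pformula M n) : Prop :=
  forall i, A ((tagged g).2 i).

(* U-saturated *)
Definition fo_saturated (U : Type) (L : fo_signature) (M : fo_structure L) :
    Prop :=
  forall (A : set M) (n : nat) (G : set (fo_pformula M n)),
    card_lt A [set: U] -> G `<=` fo_over A ->
    (forall H, H `<=` G -> finite_set H ->
       exists x : 'I_n -> M, H `<=` fo_psat x) ->
    exists x : 'I_n -> M, G `<=` fo_psat x.

(** Continuous logic for bounded complete metric structures, normalized so that
    metrics and predicates take their values in [0, 1] *)

Definition modulus (R : realType) :=
  {D : R -> R | forall e, 0 < e -> 0 < D e}.

Record cont_signature (R : realType) := ContSignature {
  cfun_sym : Type ;
  cfun_ar : cfun_sym -> nat ;
  cfun_mod : cfun_sym -> modulus R ;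
  cpred_sym : Type ;
  cpred_ar : cpred_sym -> nat ;
  cpred_mod : cpred_sym -> modulus R }.

Definition unit_cube (R : realType) (k : nat) : set 'rV[R]_k :=
  [set x | forall i, 0 <= x ord0 i <= 1].
Arguments unit_cube : clear implicits.

Record connective (R : realType) (k : nat) := Connective {
  connective_fun :> 'rV[R]_k -> R ;
  connective_continuous : {within unit_cube R k, continuous connective_fun} ;
  connective_range : forall x, unit_cube R k x -> 0 <= connective_fun x <= 1 }.

Inductive cformula (R : realType) (L : cont_signature R) : nat -> Type :=
| Dist n of term (@cfun_ar R L) n & term (@cfun_ar R L) n : cformula L n
| Pred n (P : cpred_sym L) of ('I_(cpred_ar P) -> term (@cfun_ar R L) n) :
    cformula L n
| Conn n k (c : connective R k) of ('I_k -> cformula L n) : cformula L n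
| Sup n of cformula L (1 + n) : cformula L n
| Inf n of cformula L (1 + n) : cformula L n.

Record cont_structure (R : realType) (L : cont_signature R) := ContStructure {
  cont_carrier :> metricType R ;
  cont_nonempty : inhabited cont_carrier ;
  cont_complete : forall F : set_system cont_carrier,
    ProperFilter F -> cauchy F -> exists x : cont_carrier, F --> x ;
  cont_bounded : forall x y : cont_carrier, mdist x y <= 1 ;
  cont_fun : forall f : cfun_sym L,
    ('I_(cfun_ar f) -> cont_carrier) -> cont_carrier ;
  cont_fun_unif : forall (f : cfun_sym L) (x y : 'I_(cfun_ar f) -> cont_carrier)
      (e : R), 0 < e ->
    (forall i, mdist (x i) (y i) < sval (cfun_mod f) e) ->
    mdist (cont_fun x) (cont_fun y) <= e ;
  cont_pred : forall P : cpred_sym L, ('I_(cpred_ar P) -> cont_carrier) -> R ;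
  cont_pred_range : forall (P : cpred_sym L) (x : 'I_(cpred_ar P) -> cont_carrier),
    0 <= cont_pred x <= 1 ;
  cont_pred_unif : forall (P : cpred_sym L)
      (x y : 'I_(cpred_ar P) -> cont_carrier) (e : R), 0 < e ->
    (forall i, mdist (x i) (y i) < sval (cpred_mod P) e) ->
    `|cont_pred x - cont_pred y| <= e }.

Fixpoint cval (R : realType) (L : cont_signature R) (M : cont_structure L)
    (n : nat) (p : cformula L n) : ('I_n -> M) -> R :=
  match p in cformula _ n return ('I_n -> M) -> R with
  | Dist _ t u => fun v =>
      mdist (teval (@cont_fun R L M) v t) (teval (@cont_fun R L M) v u)
  | Pred _ P ts => fun v =>
      @cont_pred R L M P (fun i => teval (@cont_fun R L M) v (ts i))
  | Conn _ k c ps => fun v => c (\row_(i < k) cval (ps i) v)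
  | Sup _ p => fun v => sup (range (fun x : M => cval p (vcons x v)))
  | Inf _ p => fun v => inf (range (fun x : M => cval p (vcons x v)))
  end.

(* A sentence p of a continuous theory stands for the closed condition p = 0. *)
Definition cont_theory (R : realType) (L : cont_signature R) :=
  set (cformula L 0).

Definition cont_models (R : realType) (L : cont_signature R)
    (M : cont_structure L) (T : cont_theory L) : Prop :=
  forall p, T p -> cval p (@vnil M) = 0.

Definition cont_complete_theory (R : realType) (L : cont_signature R)
    (T : cont_theory L) : Prop :=
  (exists M : cont_structure L, cont_models M T) /\
  forall p : cformula L 0, exists r : R,
    forall M : cont_structure L, cont_models M T -> cval p (@vnil M) = r.

Definition cont_pformula (R : realType) (L : cont_signature R)
    (M : cont_structure L) (n : nat) :=
  {k : nat & cformula L (n + k) * ('I_k -> M)}%type.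

Definition cont_psat (R : realType) (L : cont_signature R)
    (M : cont_structure L) (n : nat) (x : 'I_n -> M)
    (g : cont_pformula M n) : Prop :=
  cval (tagged g).1 (vcat x (tagged g).2) = 0.

Definition cont_over (R : realType) (L : cont_signature R)
    (M : cont_structure L) (n : nat) (A : set M) (g : cont_pformula M n) : Prop :=
  forall i, A ((tagged g).2 i).

Definition cont_saturated (U : Type) (R : realType) (L : cont_signature R)
    (M : cont_structure L) : Prop :=
  forall (A : set M) (n : nat) (G : set (cont_pformula M n)),
    card_lt A [set: U] -> G `<=` cont_over A ->
    (forall H, H `<=` G -> finite_set H ->
       exists x : 'I_n -> M, H `<=` cont_psat x) ->
    exists x : 'I_n -> M, G `<=` cont_psat x.

(** Big models, for the cardinal of U *)

Variant big_model (R : realType) (U : Type) : Type :=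
| FOBigModel (L : fo_signature) (T : fo_theory L) (M : fo_structure L) of
    fo_complete T & fo_models M T &
    finite_set [set: M] \/ ([set: M] #= [set: U] /\ fo_saturated U M)
| ContBigModel (L : cont_signature R) (T : cont_theory L)
    (M : cont_structure L) of
    cont_complete_theory T & cont_models M T &
    finite_set [set: M] \/ ([set: M] #= [set: U] /\ cont_saturated U M).

Definition big_carrier (R : realType) (U : Type) (N : big_model R U) : Type :=
  match N with
  | FOBigModel _ _ M _ _ _ => M
  | ContBigModel _ _ M _ _ _ => M
  end.
Coercion big_carrier : big_model >-> Sortclass.

(** Ternary relations on small sets *)

Record small_set (U N : Type) := SmallSet {
  small_set_val :> set N ;
  small_setP : card_lt small_set_val [set: U] }.

(* [I A B C] is written A |I_C B on paper: the base comes last. *)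
Definition ternary (U N : Type) :=
  small_set U N -> small_set U N -> small_set U N -> Prop.

Section Ternary.
Variables U N : Type.
Implicit Types (I J : ternary U N) (A B C D : small_set U N).

Definition countable_approx I A B C : Prop :=
  forall A' B' C', countable A' -> countable B' -> countable C' ->
    A' `<=` A -> B' `<=` B -> C' `<=` C ->
    exists D, [/\ countable D, C' `<=` D, D `<=` C & I A' B' D].

Definition countably_based I : Prop :=
  forall A B C, I A B C <-> countable_approx I A B C.

Definition monotonicity I : Prop :=
  forall A B C A' B', I A B C -> A' `<=` A -> B' `<=` B -> I A' B' C.

Definition two_sided_countable_character I : Prop :=
  forall A B C,
    (forall A0 B0, countable A0 -> countable B0 -> A0 `<=` A -> B0 `<=` B ->
       I A0 B0 C) ->
    I A B C.

Definition agree_on_countable I J : Prop :=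
  forall A B C, countable A -> countable B -> countable C ->
    (I A B C <-> J A B C).

End Ternary.

(* Main.v *)
Require Import Defs.
From mathcomp Require Import all_boot all_order all_algebra.
From mathcomp Require Import all_classical all_reals all_analysis.
Local Open Scope classical_set_scope.

(** Being countably based means being a fixed point of the operator [countable_approx], which
    consults a relation only at triples of countable sets and is monotone in it
    ([countable_approx_le]). So inclusion or equality on countable triples propagates to all small
    sets, giving (1) and uniqueness in (2). For monotone [I] the operator does not change [I] on
    countable triples ([countable_approx_agree]), so applying it twice is the same as applying it
    once, giving existence. In (3), monotonicity and two-sided character reduce to countable [A] and
    [B], where the remaining clause approximates the base alone. *)

Section CountablyBased.
Set Implicit Arguments.
Unset Strict Implicit.
Variables U N : Type.
Implicit Types (I J : ternary U N) (A B C : small_set U N).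

Lemma small_set_inj A B : A = B :> set N -> A = B.
Proof.
case: A B => [A hA] [B hB] /= AB; move: hA hB; rewrite AB => hA hB.
by rewrite (Prop_irrelevance hA hB).
Qed.

(** True for every [I]: shrinking [A] and [B] leaves fewer countable pairs to test. *)
Lemma countable_approx_monotonicity I : monotonicity (countable_approx I).
Proof.
move=> A B C A' B' h sA sB A0 B0 C0 cA cB cC sA0 sB0 sC0.
by apply: h => //; [exact: subset_trans sA|exact: subset_trans sB].
Qed.

Lemma countable_approx_le I J :
  (forall A B C, countable A -> countable B -> countable C ->
     I A B C -> J A B C) ->
  forall A B C, countable_approx I A B C -> countable_approx J A B C.
Proof.
move=> IJ A B C h A' B' C' cA cB cC sA sB sC.
have [D [cD C'D DC ID]] := h A' B' C' cA cB cC sA sB sC.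
by exists D; split => //; exact: IJ.
Qed.

Lemma countably_based_le I J : countably_based I -> countably_based J ->
  (forall A B C, countable A -> countable B -> countable C ->
     I A B C -> J A B C) ->
  forall A B C, I A B C -> J A B C.
Proof.
by move=> hI hJ IJ A B C /hI /(countable_approx_le IJ) /hJ.
Qed.

Lemma countable_approx_agree I : monotonicity I ->
  agree_on_countable (countable_approx I) I.
Proof.
move=> mI A B C cA cB cC; split=> [h|h A' B' C' _ _ _ sA sB sC].
  (* Testing at [C' = C] squeezes [D] to [C]. Conversely, the countable base [C] serves as [D] for
     every [C']. *)
  have [D [_ CD DC ID]] := h A B C cA cB cC
    (@subset_refl _ _) (@subset_refl _ _) (@subset_refl _ _).
  by have <- : D = C by apply: small_set_inj; apply/seteqP.
by exists C; split => //; exact: mI h sA sB.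
Qed.

Lemma countable_approx_based I : monotonicity I ->
  countably_based (countable_approx I).
Proof.
move=> mI A B C.
by split; apply: countable_approx_le => A' B' C' cA cB cC;
  rewrite (countable_approx_agree mI).
Qed.

Lemma countably_based_unique I J : countably_based I -> countably_based J ->
  agree_on_countable I J -> I = J.
Proof.
move=> hI hJ IJ; apply/funext => A; apply/funext => B; apply/funext => C.
apply/propext; split; apply: countably_based_le => // A' B' C' cA cB cC.
  by move/(IJ _ _ _ cA cB cC).
by move/(IJ _ _ _ cA cB cC).
Qed.

Lemma countably_basedP I :
  countably_based I <->
  [/\ monotonicity I,
      two_sided_countable_character I &
      forall A B C, countable A -> countable B ->
        (I A B C <->
         (forall C' : small_set U N, countable C' -> C' `<=` C ->
            exists D : small_set U N,
              [/\ countable D, C' `<=` D, D `<=` C & I A B D]))].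
Proof.
split=> [hI|[mI tI bI] A B C].
  have mI : monotonicity I.
    move=> A B C A' B' /hI h sA sB; apply/hI.
    exact: countable_approx_monotonicity h sA sB.
  split=> //.
    move=> A B C h; apply/hI => A' B' C' cA cB cC sA sB sC.
    (* The test at [A'], [B'], [C'] is already part of the approximation for the pair [A'], [B']
       itself. *)
    by have /hI := h A' B' cA cB sA sB; apply.
  move=> A B C cA cB; split=> [/hI h C' cC sC|h]; first exact: h.
  (* A [D] found for the whole of [A] and [B] also serves [A'] and [B'], by monotonicity. *)
  apply/hI => A' B' C' _ _ cC sA sB sC.
  have [D [cD C'D DC ID]] := h C' cC sC.
  by exists D; split => //; exact: mI ID sA sB.
split=> [h A' B' C' cA cB cC sA sB sC|h].
  exact: (bI _ _ _ cA cB).1 (mI _ _ _ _ _ h sA sB) _ cC sC.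
(* Once [A'] and [B'] are countable, the criterion on the base asks exactly for an instance of
   [h]. *)
apply: tI => A' B' cA cB sA sB; apply/(bI _ _ _ cA cB) => C' cC sC.
exact: h.
Qed.

End CountablyBased.

Theorem lemma4p1p4 (R : realType) (U : Type) (hU : inaccessible U)
    (N : big_model R U) :
  (forall I J : ternary U N, countably_based I -> countably_based J ->
     (forall A B C : small_set U N,
        countable A -> countable B -> countable C -> I A B C -> J A B C) ->
     forall A B C : small_set U N, I A B C -> J A B C)
  /\
  (forall I : ternary U N, monotonicity I ->
     exists Ic : ternary U N,
       unique (fun J : ternary U N =>
                 countably_based J /\ agree_on_countable J I) Ic /\
       (forall A B C : small_set U N,
          Ic A B C <->
          (forall A' B' C' : small_set U N,
             countable A' -> countable B' -> countable C' ->
             A' `<=` A -> B' `<=` B -> C' `<=` C ->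
             exists D : small_set U N,
               [/\ countable D, C' `<=` D, D `<=` C & I A' B' D])))
  /\
  (forall I : ternary U N,
     countably_based I <->
     [/\ monotonicity I,
         two_sided_countable_character I &
         forall A B C : small_set U N, countable A -> countable B ->
           (I A B C <->
            (forall C' : small_set U N, countable C' -> C' `<=` C ->
               exists D : small_set U N,
                 [/\ countable D, C' `<=` D, D `<=` C & I A B D]))]).
Proof.
split; first exact: countably_based_le.
split=> [I mI|I]; last exact: countably_basedP.
have bI := countable_approx_based mI; have aI := countable_approx_agree mI.
exists (countable_approx I); split=> //; split=> // J [bJ aJ].
(* Both relations agree with [I] on countable triples, hence with each other. *)
apply: countably_based_unique => // A B C cA cB cC.
by rewrite (aI _ _ _ cA cB cC) (aJ _ _ _ cA cB cC).
Qed.
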